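(* Let $n\ge 3$ and $0\le j\le n-3$ be integers. The coefficients $a_{n,j}$ of the polynomial $A_n(b)=\sum_{j=0}^{n-3} a_{n,j} b^j$ are given by $$a_{n,j} = \frac{(-1)^{j}}{(j+1)!} \binom{n-2}{j+1}\, s(j+2,2),$$ where $s(\cdot,\cdot)$ denotes the signed Stirling numbers of the first kind.
   Context: For an integer $n\ge 2$ and $b>0$ put $h_{n,1}(b)=\int_0^b \frac{\ln t\,dt}{(1+t)^n}$ and $q_n(b)=(1+b)^{n-1}h_{n,1}(b)$. Write $q_n(b)=X_n(b)\ln b+Y_n(b)\ln(1+b)+Z_n(b)$ with $X_n(b)=\frac{(1+b)^{n-1}-1}{n-1}$ and $Y_n(b)=-\frac{(1+b)^{n-1}}{n-1}$ (this defines $Z_n$). Set $T_n(b)=-\frac{(n-1)!\,Z_n(b)}{b(1+b)}$ and $A_n(b)=\frac{1}{(n-2)!}T_n(b)$. It is known from earlier work that $T_2(b)=0$ and $T_{n+2}(b)=n(1+b)T_{n+1}(b)+(n-1)!\,\frac{(1+b)^n-1}{b}$ for $n\ge 1$; equivalently $A_2(b)=0$ and $A_{n+2}(b)=(1+b)A_{n+1}(b)+\frac{(1+b)^n-1}{bn}$ for $n\ge1$. In particular, for $n\ge3$, $A_n$ is a polynomial in $b$ of degree $n-3$, written $A_n(b)=\sum_{j=0}^{n-3}a_{n,j}b^j$. The signed Stirling numbers of the first kind $s(n,j)$ are defined by $x(x-1)\cdots(x-n+1)=\sum_{j=1}^n s(n,j)x^j$ for $n\ge1$; thus $s(n,1)=(-1)^{n-1}(n-1)!$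 and $s(n+1,j)=s(n,j-1)-n\,s(n,j)$. *)

(* Defs.v *)
From mathcomp Require Import all_boot all_order all_algebra.
From mathcomp Require Import all_classical all_reals all_analysis.

Set Implicit Arguments.
Unset Strict Implicit.
Unset Printing Implicit Defensive.

Import Order.TTheory GRing.Theory Num.Theory.
Import numFieldNormedType.Exports.

Local Open Scope ring_scope.

Section LogIntegral.
Context {R : realType}.
Implicit Types (n : nat) (b : R).

(* The integrand is unbounded at 0 but absolutely integrable on ]0, b], so the
   Lebesgue integral is the improper integral from 0 to b. *)
Definition hn1 n b : R :=
  \int[lebesgue_measure]_(t in `]0, b]%classic) (ln t / (1 + t) ^+ n).

Definition qn n b : R := (1 + b) ^+ n.-1 * hn1 n b.

Definition Xn n b : R := ((1 + b) ^+ n.-1 - 1) / n.-1%:R.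

Definition Yn n b : R := - ((1 + b) ^+ n.-1 / n.-1%:R).

(* The solution Z of  q = X * ln b + Y * ln (1 + b) + Z. *)
Definition Zn n b : R := qn n b - Xn n b * ln b - Yn n b * ln (1 + b).

Definition Tn n b : R := - ((n.-1)`!%:R * Zn n b / (b * (1 + b))).

Definition An n b : R := ((n - 2)`!%:R)^-1 * Tn n b.

End LogIntegral.

(* Signed Stirling numbers of the first kind: the coefficient of 'X^j in
   'X * ('X - 1) * ... * ('X - (n - 1)). *)
Definition stirling1 (n j : nat) : int :=
  (\prod_(0 <= i < n) ('X - (i%:Z)%:P) : {poly int})`_j.

(* Main.v *)
(* Integrating by parts, with u = 1/(1+b),
     (n-1) h_n(b) = (1 - u^(n-1)) ln b - ln (1+b) - \sum_(1 <= k < n-1) (1 - u^k)/k;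
   the logarithmic terms are exactly those of X_n ln b + Y_n ln (1+b),
   so with N = n - 2 one gets
     b A_n(b) = B_N(b) := (1+b)^N \sum_(1 <= k <= N) (1 - (1+b)^(-k))/k.
   Since B_(N+1) = (1+b) B_N + ((1+b)^(N+1) - 1)/(N+1), Pascal's rule gives
   B_N = \sum_j C(N,j) H_j b^j with H_j the harmonic numbers, and
   s(j+2,2) = (-1)^j (j+1)! H_(j+1). *)

Require Import Defs.
From mathcomp Require Import all_boot all_order all_algebra.
From mathcomp Require Import all_classical all_reals all_analysis.
From mathcomp Require Import measurable_realfun.
From mathcomp Require Import ring lra.

Import Order.TTheory GRing.Theory Num.Theory.
Import numFieldNormedType.Exports.

Local Open Scope ring_scope.

(** * Harmonic numbers and Stirling numbers of the first kind *)

Definition harm (F : fieldType) (k : nat) : F := \sum_(i < k) i.+1%:R^-1.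

Lemma harmS (F : fieldType) k : harm F k.+1 = harm F k + k.+1%:R^-1.
Proof. by rewrite /harm big_ord_recr. Qed.

Lemma stirling1S n j :
  stirling1 n.+1 j.+1 = stirling1 n j - n%:Z * stirling1 n j.+1.
Proof.
rewrite /stirling1 big_nat_recr//= mulrBr coefB coefMX/= coefMC; ring.
Qed.

Lemma stirling1_0 n : stirling1 n.+1 0 = 0.
Proof.
by rewrite /stirling1 big_nat_recl//= subr0 coefXM.
Qed.

Lemma stirling1_1 n : stirling1 n.+1 1 = (-1) ^+ n * n`!%:Z.
Proof.
elim: n => [|n IHn]; first by rewrite /stirling1 big_nat1 subr0 coefX.
by rewrite stirling1S stirling1_0 IHn exprS factS PoszM; ring.
Qed.

(** Induction on [n] through [stirling1S]: the term [stirling1 n.+2 1], a signed factorial, supplies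
    the new summand [1/(n+2)] of the harmonic number. *)
Lemma stirling1_2 (F : numFieldType) n :
  (stirling1 n.+2 2)%:~R = (-1) ^+ n * n.+1`!%:R * harm F n.+1 :> F.
Proof.
elim: n => [|n IHn].
  rewrite stirling1S stirling1_1 stirling1S {1}/stirling1 big_geq// coefC/=.
  by rewrite mul0r /harm big_ord1 invr1 !mulr1 subr0.
rewrite stirling1S rmorphB rmorphM/= IHn stirling1_1 (harmS _ n.+1) rmorphM/= rmorphXn/=.
rewrite [n.+2`!]factS natrM exprS -!pmulrn.
rewrite rmorphN rmorph1.
field. by rewrite -(natrD F 2 n) pnatr_eq0.
Qed.

(** * Polynomials with binomial-harmonic coefficients *)

Definition binharm_poly (F : fieldType) N : {poly F} :=
  \poly_(i < N.+1) ('C(N, i)%:R * harm F i).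

Lemma coef_binharm_poly (F : fieldType) N i :
  (binharm_poly F N)`_i = 'C(N, i)%:R * harm F i.
Proof. by rewrite coef_poly; case: ltnP => // Ni; rewrite bin_small// mul0r. Qed.

Lemma coef_1DX_exp (R : nzRingType) n i : ((1 + 'X : {poly R}) ^+ n)`_i = 'C(n, i)%:R.
Proof.
elim: n i => [|n IHn] i; first by rewrite expr0 coef1; case: i.
rewrite exprS mulrDl mul1r coefD coefXM IHn.
by case: i => [|i]/=; rewrite ?bin0 ?addr0// IHn binS natrD.
Qed.

(** Pascal's rule splits the coefficient of ['X^(i+1)]; passing from [harm F i] to [harm F i.+1]
    leaves [C(N,i)/(i+1)], which by absorption is [C(N+1,i+1)/(N+1)], a coefficient of the last
    summand. *)
Lemma binharm_polyS (F : numFieldType) N :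
  binharm_poly F N.+1 = (1 + 'X) * binharm_poly F N
    + N.+1%:R^-1 *: ((1 + 'X) ^+ N.+1 - 1).
Proof.
apply/polyP => i; rewrite coefD coefZ coefB coef1 mulrDl mul1r coefD coefXM.
rewrite coef_1DX_exp !coef_binharm_poly; case: i => [|i]/=.
  by rewrite !bin0 /harm big_ord0; ring.
have binE : 'C(N.+1, i.+1)%:R = N.+1%:R / i.+1%:R * 'C(N, i)%:R :> F.
  apply: (mulfI (_ : i.+1%:R != 0)); first by rewrite pnatr_eq0.
  by rewrite -natrM -mul_bin_diag natrM; field; rewrite nat1r pnatr_eq0.
have -> : 'C(N, i.+1)%:R = 'C(N.+1, i.+1)%:R - 'C(N, i)%:R :> F.
  by rewrite binS natrD addrK.
rewrite binE harmS; field.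
by rewrite nat1r pnatr_eq0 nat1r pnatr_eq0.
Qed.

(** Both sides satisfy the recurrence of [binharm_polyS]: multiplied by [(1+b)^(N+1)], the summand
    [k = N] becomes [((1+b)^(N+1) - 1)/(N+1)]. *)
Lemma horner_binharm_poly (F : numFieldType) N (b : F) : 1 + b != 0 ->
  (binharm_poly F N).[b] =
    (1 + b) ^+ N * \sum_(k < N) (1 - (1 + b) ^- k.+1) / k.+1%:R.
Proof.
move=> b1; elim: N => [|N IHN].
  by rewrite /binharm_poly poly_def big_ord1 /harm !big_ord0 !mulr0 scale0r horner0.
rewrite binharm_polyS big_ord_recr/= !hornerE IHN exprS.
by field; rewrite nat1r pnatr_eq0 b1 expf_neq0.
Qed.

Lemma eq_poly_pos (F : numFieldType) (p q : {poly F}) :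
  (forall b, 0 < b -> p.[b] = q.[b]) -> p = q.
Proof.
move=> pq; apply/eqP; rewrite -subr_eq0; apply/eqP.
(* The points [1, ..., size (p - q)] are positive, and distinct in characteristic zero: too many
   roots for a nonzero [p - q]. *)
pose s := [seq i.+1%:R : F | i <- iota 0 (size (p - q))].
apply: (@roots_geq_poly_eq0 _ _ s).
- apply/allP => _ /mapP[i _ ->].
  by rewrite rootE hornerD hornerN pq ?ltr0n// subrr.
- by rewrite map_inj_uniq ?iota_uniq// => i j /eqP; rewrite eqr_nat => /eqP[].
- by rewrite size_map size_iota.
Qed.

(** * Integration over half-open intervals and the closed form of [hn1] *)

Section Analysis.
Local Open Scope classical_set_scope.
Local Open Scope ring_scope.

(** Since [f] may be singular at [a], the interval is exhausted by the compact [A n]; the usual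
    theorem applies on each, and monotone convergence, where [0 <= f] enters, passes to the
    limit. *)
Lemma ge0_continuous_oc_FTC2 (R : realType) (f F : R -> R) (a b : R) : a < b ->
  (forall x, x \in `]a, b] -> 0 <= f x) ->
  {within `]a, b], continuous f} ->
  (forall x, x \in `]a, b[ -> is_derive x 1 F (f x)) ->
  F x @[x --> a^'+] --> F a -> F x @[x --> b^'-] --> F b ->
  (\int[lebesgue_measure]_(x in `]a, b]) (f x)%:E = (F b)%:E - (F a)%:E)%E.
Proof.
move=> ab f0 cf dF Fa Fb.
pose A n := `[(a + n.+1%:R^-1)%R, b]%classic : set R.
have sub (c : R) : a < c -> `[c, b] `<=` `]a, b].
  by move=> ac; apply: subset_itvr; rewrite bnd_simp.
have an n : a < a + n.+1%:R^-1 by rewrite ltrDl invr_gt0 ltr0n.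
have cfA n : {within A n, continuous f} by apply: continuous_subspaceW cf; exact: sub.
have cvgA : (\int[lebesgue_measure]_(x in A i) (f x)%:E)%E @[i --> \oo] -->
    (\int[lebesgue_measure]_(x in `]a, b]) (f x)%:E)%E.
  rewrite itv_open_bnd_bigcup.
  apply: ge0_nondecreasing_set_cvg_integral => //.
  - move=> m n mn; rewrite subsetEset; apply: subset_itvr; rewrite bnd_simp.
    by rewrite lerD2l lef_pV2 ?posrE ?ltr0n// ler_nat.
  - by move=> i; exact: measurable_itv.
  - move=> i; apply/measurable_EFinP; apply: subspace_continuous_measurable_fun.
      exact: measurable_itv.
    exact: cfA.
  - by move=> i x /(sub _ (an i)) xab; rewrite lee_fin f0.
apply/esym/(cvg_unique _ _ cvgA) => //.
have cvg_an : (a + n.+1%:R^-1) @[n --> \oo] --> a.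
  by rewrite -[X in _ --> X]addr0; apply: cvgD; [exact: cvg_cst|exact: cvg_harmonic].
suff : (F b - F (a + n.+1%:R^-1))%:E @[n --> \oo] --> (F b - F a)%:E.
  apply: cvg_trans; apply: near_eq_cvg; near=> n.
  (* The point [a + 1/(n+1)] lies left of [b] only for large [n]. It is then interior, so
     differentiability of [F] gives its continuity there. *)
  have anb : a + n.+1%:R^-1 < b.
    by near: n; exact: (cvgr_lt _ cvg_an).
  have anP x : x \in `]a + n.+1%:R^-1, b[ -> x \in `]a, b[.
    by apply: subset_itvr; rewrite bnd_simp ltW.
  rewrite (@continuous_FTC2 _ f F)//.
  - exact: cfA.
  - split => //.
    + by move=> x /anP /dF [].
    + apply: cvg_at_right_filter; apply: differentiable_continuous.
      apply/derivable1_diffP.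
      by apply: (@ex_derive _ _ _ _ _ _ _ (dF _ _)); rewrite in_itv/= an.
  - by move=> x /anP xab; rewrite derive1E; have [_ ->] := dF _ xab.
apply: cvg_EFin; first exact: nearW.
apply: cvgB; first exact: cvg_cst.
by apply: (cvg_at_rightP _ _ _).1 Fa _ _; split.
Unshelve. all: by end_near. Qed.

(* Apply the nonnegative case to M - f, with primitive M x - F x. *)
Lemma upper_bounded_oc_FTC2 (R : realType) (f F : R -> R) (a b M : R) : a < b ->
  (forall x, x \in `]a, b] -> f x <= M) ->
  {within `]a, b], continuous f} ->
  (forall x, x \in `]a, b[ -> is_derive x 1 F (f x)) ->
  F x @[x --> a^'+] --> F a -> F x @[x --> b^'-] --> F b ->
  \int[lebesgue_measure]_(x in `]a, b]) f x = F b - F a.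
Proof.
move=> ab fM cf dF Fa Fb.
have cMf : {within `]a, b], continuous (fun x => M - f x)}.
  by move=> x; apply: cvgB; [exact: cvg_cst|exact: cf].
have MfE := @ge0_continuous_oc_FTC2 _ (fun x => M - f x) (fun x => M * x - F x) a b ab.
have {}MfE : (\int[lebesgue_measure]_(x in `]a, b]) (M - f x)%:E =
    (M * b - F b)%:E - (M * a - F a)%:E)%E.
  apply: MfE => //.
  - by move=> x /fM; rewrite subr_ge0.
  - move=> x xab; have dFx := dF x xab.
    have -> : M - f x = M *: 1 - f x by rewrite [_ *: _]mulr1.
    exact: is_deriveB.
  - apply: cvgB Fa; apply: cvg_at_right_filter; exact: mulrl_continuous.
  - apply: cvgB Fb; apply: cvg_at_left_filter; exact: mulrl_continuous.
have mfin : lebesgue_measure (`]a, b]%classic : set R) = (b - a)%:E.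
  by rewrite lebesgue_measure_itv/= lte_fin ab.
have iM : (@lebesgue_measure R).-integrable `]a, b] (EFin \o cst M).
  apply: (@integrableS _ _ _ (@lebesgue_measure R) `[a, b]%classic); try exact: measurable_itv.
    exact: subset_itv_oc_cc.
  apply: continuous_compact_integrable; first exact: segment_compact.
  by apply: continuous_subspaceT; exact: cst_continuous.
(* As [M - f] is nonnegative, [MfE] computes the integral of its norm, which is therefore finite. *)
have iMf : (@lebesgue_measure R).-integrable `]a, b] (EFin \o (fun x => M - f x)).
  apply/integrableP; split.
    apply/measurable_EFinP; apply: subspace_continuous_measurable_fun.
      exact: measurable_itv.
    exact: cMf.
  under eq_integral.
    move=> x; rewrite inE/= => xab.
    rewrite ger0_norm ?subr_ge0 ?fM//; over.
  by rewrite MfE -EFinB ltry.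
have -> : \int[lebesgue_measure]_(x in `]a, b]) f x =
    \int[lebesgue_measure]_(x in `]a, b]) (M - (M - f x)).
  by apply: eq_Rintegral => x _; rewrite subKr.
rewrite (@RintegralB _ _ _ _ _ (cst M))// Rintegral_cst//.
rewrite [X in fine X]mfin /Rintegral MfE/=; ring.
Qed.

(* A primitive of (N+1) ln t / (1+t)^(N+2). It vanishes at t = 0 because the
   library sets ln 0 = 0, and it is right-continuous there. *)
Definition log_prim (R : realType) N (t : R) : R :=
  (1 - (1 + t) ^- N.+1) * ln t - ln (1 + t)
    - \sum_(k < N) (1 - (1 + t) ^- k.+1) / k.+1%:R.

Lemma is_derive_1D (R : realType) (t : R) : is_derive t 1 (fun s : R => 1 + s) 1.
Proof.
by have := is_deriveD (is_derive_cst (1 : R) t 1) (is_derive_id t 1); rewrite add0r.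
Qed.

Lemma is_derive_1D_exprVn (R : realType) n (t : R) : 1 + t != 0 ->
  is_derive t 1 (fun s => (1 + s) ^- n) (- (n%:R * (1 + t) ^- n.+1)).
Proof.
move=> t1.
have dt : is_derive t 1 (fun s : R => 1 + s) 1.
  exact: is_derive_1D.
case: n => [|n].
  rewrite mul0r oppr0; under eq_fun do rewrite expr0 invr1; exact: is_derive_cst.
have dX : is_derive t 1 (fun s : R => (1 + s) ^+ n.+1) (n.+1%:R * (1 + t) ^+ n).
  by have := is_deriveX n.+1 dt; rewrite exprfctE/= [_ *: _]mulr1.
have dV := @is_deriveV _ (fun s => (1 + s) ^+ n.+1) t _ 1 (expf_neq0 _ t1) dX.
apply: (is_derive_eq dV).
rewrite [_ *: _]mulrC !exprS; field.
by rewrite t1 expf_neq0.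
Qed.

Lemma is_derive_ln1D (R : realType) (t : R) : 0 < 1 + t ->
  is_derive t 1 (fun s : R => ln (1 + s)) (1 + t)^-1.
Proof.
move=> t1; have := is_derive1_comp (is_derive1_ln t1) (is_derive_1D R t).
by rewrite mulr1.
Qed.

Lemma log_primS (R : realType) N (t : R) :
  log_prim R N.+1 t = log_prim R N t
    + (((1 + t) ^- N.+1 - (1 + t) ^- N.+2) * ln t
       - (1 - (1 + t) ^- N.+1) / N.+1%:R).
Proof. by rewrite /log_prim big_ord_recr/=; ring. Qed.

(** Induction on [N], with [u = 1/(1+t)]. In the derivative of the increment from [log_primS],
    [(u^(N+1) - u^(N+2))/t = u^(N+2)] cancels against the derivative of [(1 - u^(N+1))/(N+1)]; what
    remains is the difference of consecutive integrands. *)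
Lemma is_derive_log_prim (R : realType) N (t : R) : 0 < t ->
  is_derive t 1 (log_prim R N) (N.+1%:R * (ln t / (1 + t) ^+ N.+2)).
Proof.
move=> t0; have tn0 : t != 0 by lra.
have t1 : 1 + t != 0 by lra.
have dln := is_derive1_ln t0.
have dX n := is_derive_1D_exprVn R n t t1.
elim: N => [|N IHN].
  have dln1 : is_derive t 1 (fun s : R => ln (1 + s)) (1 + t)^-1.
    by apply: is_derive_ln1D; lra.
  have -> : log_prim R 0 = (fun s => (1 - (1 + s) ^- 1) * ln s - ln (1 + s)).
    by apply/funext => s; rewrite /log_prim big_ord0 subr0.
  have d1X : is_derive t 1 (fun s : R => 1 - (1 + s) ^- 1) ((1 + t) ^- 2).
    have d := is_deriveB (is_derive_cst (1 : R) t 1) (dX 1%N).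
    apply: (is_derive_eq d).
    by rewrite sub0r opprK mul1r.
  apply: (is_derive_eq (is_deriveB (is_deriveM d1X dln) dln1)).
  rewrite /GRing.scale/=; field.
  by rewrite t1.
have -> : log_prim R N.+1 = (fun s => log_prim R N s
    + (((1 + s) ^- N.+1 - (1 + s) ^- N.+2) * ln s
       - N.+1%:R^-1 * (1 - (1 + s) ^- N.+1))).
  by apply/funext => s; rewrite log_primS; congr (_ + (_ - _)); rewrite mulrC.
have dB := is_deriveB (is_deriveM (is_deriveB (dX N.+1) (dX N.+2)) dln)
  (is_deriveZ N.+1%:R^-1 (is_deriveB (is_derive_cst (1 : R) t 1) (dX N.+1))).
apply: (is_derive_eq (is_deriveD IHN dB)).
rewrite /GRing.scale/=.
rewrite addrfctE opprfctE/= !exprS; field.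
by rewrite expf_neq0//= t1 tn0 nat1r pnatr_eq0.
Qed.

Lemma cvg_mul_ln_0 (R : realType) : t * ln t @[t --> (0 : R)^'+] --> (0 : R).
Proof.
(* - 2 sqrt t <= t ln t <= 0, from ln (1 / sqrt t) < 1 / sqrt t *)
have cvg_sqrt : - (2 * Num.sqrt t) @[t --> (0 : R)^'+] --> (0 : R).
  rewrite -[X in _ --> X]oppr0 -[X in _ --> - X](mulr0 2); apply: cvgN.
  apply: cvgMr; rewrite -[X in _ --> X](sqrtr0 R); apply: cvg_at_right_filter.
  exact: sqrt_continuous.
apply: (squeeze_cvgr _ cvg_sqrt (cvg_cst _)).
near=> t.
have t0 : 0 < t by [].
have tle1 : t <= 1 by near: t; apply: nbhs_right_le.
have s0 : 0 < Num.sqrt t by rewrite sqrtr_gt0.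
apply/andP; split; last by rewrite mulr_ge0_le0 ?ln_le0// ltW.
have := @ln_sublinear _ (Num.sqrt t)^-1; rewrite invr_gt0 => /(_ s0).
rewrite lnV// => h.
rewrite -[in leRHS](sqr_sqrtr (ltW t0)) lnXn//.
move: s0 h; set s := Num.sqrt t => s0 h.
have := mulVf (lt0r_neq0 s0); nra.
Unshelve. all: by end_near. Qed.

(** Only [(1 - u^(N+1)) ln t], with [u = 1/(1+t)], is delicate. The geometric sum and [1 - u = t u]
    extract a factor [t], reducing it to [t ln t] times a function continuous at 0. *)
Lemma log_prim_cvg0 (R : realType) N :
  log_prim R N t @[t --> 0^'+] --> log_prim R N 0.
Proof.
have cX n : (1 + t) ^- n @[t --> (0 : R)^'+] --> ((1 + 0) ^- n : R).
  apply: cvg_at_right_filter.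
  apply: (@differentiable_continuous _ _ _ _ (fun t : R => (1 + t) ^- n)).
  apply/derivable1_diffP.
  by apply: (@ex_derive _ _ _ _ _ _ _ (is_derive_1D_exprVn R n 0 _)); rewrite addr0.
have -> : log_prim R N 0 = 0 * (\sum_(i < N.+1) (1 + 0) ^- i.+1) - ln (1 + 0)
    - \sum_(k < N) (1 - (1 + 0) ^- k.+1) / k.+1%:R.
  by rewrite /log_prim addr0 expr1n invr1 subrr !mul0r.
have E : \forall t \near (0 : R)^'+, t * ln t * (\sum_(i < N.+1) (1 + t) ^- i.+1) - ln (1 + t)
    - \sum_(k < N) (1 - (1 + t) ^- k.+1) / k.+1%:R = log_prim R N t.
  near=> t; have t0 : 0 < t by [].
  have t1 : 1 + t != 0 by lra.
  rewrite /log_prim; congr (_ - _ - _).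
  rewrite mulrAC; congr (_ * _).
  have := subrXX (1 : R) (1 + t)^-1 N.+1; rewrite expr1n exprVn => ->.
  have -> : 1 - (1 + t)^-1 = t * (1 + t)^-1 by field.
  rewrite -mulrA; congr (_ * _); rewrite mulr_sumr; apply: eq_bigr => i _.
  by rewrite expr1n mul1r -exprVn -exprS.
apply: (cvg_trans (near_eq_cvg E)).
apply: cvgB; last first.
  apply: cvg_big => [|k _]; first exact: add_continuous.
  by apply: cvgMl; apply: cvgB; [exact: cvg_cst|exact: cX].
apply: cvgB; last first.
  apply: cvg_at_right_filter.
  apply: (@differentiable_continuous _ _ _ _ (fun t : R => ln (1 + t))).
  apply/derivable1_diffP.
  by apply: (@ex_derive _ _ _ _ _ _ _ (is_derive_ln1D R 0 _)); rewrite addr0.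
apply: cvgM; first exact: cvg_mul_ln_0.
by apply: cvg_big => [|i _]; [exact: add_continuous|exact: cX].
Unshelve. all: by end_near. Qed.

Lemma hn1E (R : realType) N (b : R) : 0 < b ->
  N.+1%:R * hn1 N.+2 b = log_prim R N b.
Proof.
move=> b0.
have dF (x : R) : 0 < x -> is_derive x 1 (fun t => N.+1%:R^-1 * log_prim R N t)
    (ln x / (1 + x) ^+ N.+2).
  move=> x0; apply: is_derive_eq (is_deriveZ N.+1%:R^-1 (is_derive_log_prim R N x x0)) _.
  by rewrite [_ *: _]mulKf// pnatr_eq0.
have cf (x : R) : 0 < x -> {for x, continuous (fun t : R => ln t / (1 + t) ^+ N.+2)}.
  move=> x0; apply: continuousM; first exact: continuous_ln.
  apply: differentiable_continuous; apply/derivable1_diffP.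
  by apply: (@ex_derive _ _ _ _ _ _ _ (is_derive_1D_exprVn R N.+2 x _)); lra.
have -> : hn1 N.+2 b = N.+1%:R^-1 * log_prim R N b - N.+1%:R^-1 * log_prim R N 0.
  (* The bound 1 works because [ln x < x <= (1+x)^(N+2)] for [x > 0]. *)
  apply: (@upper_bounded_oc_FTC2 _ _ (fun t => N.+1%:R^-1 * log_prim R N t) 0 b 1).
  - by [].
  - move=> x; rewrite in_itv/= => /andP[x0 _].
    have x1 : 1 <= 1 + x by lra.
    rewrite ler_pdivrMr ?exprn_gt0//; last lra.
    rewrite mul1r exprS (le_trans (ltW (ln_sublinear x0)))//.
    have := exprn_ege1 N.+1 x1; nra.
  - apply: continuous_in_subspaceT => x; rewrite inE/= in_itv/= => /andP[x0 _].
    exact: cf.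
  - by move=> x; rewrite in_itv/= => /andP[x0 _]; exact: dF.
  - by apply: cvgMr; exact: log_prim_cvg0.
  - apply: cvg_at_left_filter.
    apply: (@differentiable_continuous _ _ _ _ (fun t : R => N.+1%:R^-1 * log_prim R N t)).
    apply/derivable1_diffP.
    by apply: (@ex_derive _ _ _ _ _ _ _ (dF b b0)).
rewrite {2}/log_prim ln0// addr0 ln1 expr1n invr1 subrr mul0r subr0.
rewrite big1 => [|k _]; last by rewrite expr1n invr1 subrr mul0r.
by rewrite subr0 mulr0 subr0 mulVKf// pnatr_eq0.
Qed.

(** Once the logarithms cancel in [Zn], the factor [(N+1)!/(N+1)] cancels against [N!], and one
    power of [1+b] against the denominator of [Tn]. *)
Lemma AnE (R : realType) N (b : R) : 0 < b ->
  b * An N.+2 b = (1 + b) ^+ N * \sum_(k < N) (1 - (1 + b) ^- k.+1) / k.+1%:R.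
Proof.
move=> b0; have b1 : 1 + b != 0 by lra.
have hE : hn1 N.+2 b = log_prim R N b / N.+1%:R.
  by rewrite -(hn1E R N b b0) mulrC mulKf// pnatr_eq0.
rewrite /An /Tn /Zn /qn /Xn /Yn hE /log_prim/= subn2/= factS natrM !exprS.
field.
by rewrite b1 lt0r_neq0//= nat1r expf_neq0//= !pnatr_eq0/= -lt0n fact_gt0.
Qed.

End Analysis.

(** * Identification of the coefficients *)

Definition An_poly (F : fieldType) N : {poly F} :=
  \poly_(j < N) ('C(N, j.+1)%:R * harm F j.+1).

(** Makes the leading coefficient of [An_poly] nonzero, hence its size exact. *)
Lemma harm_gt0 (F : numFieldType) k : 0 < harm F k.+1.
Proof.
rewrite harmS ltr_wpDl ?invr_gt0 ?ltr0n//.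
by apply: sumr_ge0 => i _; rewrite invr_ge0 ler0n.
Qed.

Lemma size_An_poly (F : numFieldType) N : size (An_poly F N.+1) = N.+1.
Proof. by rewrite size_poly_eq// binn mul1r lt0r_neq0// harm_gt0. Qed.

(** The constant coefficient vanishes because [harm F 0] is an empty sum. *)
Lemma binharm_polyX (F : fieldType) N : binharm_poly F N = 'X * An_poly F N.
Proof.
apply/polyP => -[|i]; rewrite coef_binharm_poly coefXM/=.
  by rewrite /harm big_ord0 mulr0.
by rewrite coef_poly; case: ltnP => // Ni; rewrite bin_small// mul0r.
Qed.

Lemma An_horner (R : realType) N (b : R) : 0 < b -> An N.+2 b = (An_poly R N).[b].
Proof.
move=> b0; apply: (mulfI (lt0r_neq0 b0)).
rewrite AnE// -horner_binharm_poly ?binharm_polyX ?hornerM ?hornerX//.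
by rewrite lt0r_neq0// addr_gt0.
Qed.

Theorem theorem4p4 (R : realType) (n : nat) (hn : (3 <= n)%N) :
  (exists p : {poly R},
     size p = (n - 2)%N /\ (forall b : R, 0 < b -> An n b = p.[b])) /\
  (forall p : {poly R}, (forall b : R, 0 < b -> An n b = p.[b]) ->
   forall j : nat, (j <= n - 3)%N ->
     p`_j = (-1) ^+ j / (j.+1)`!%:R * ('C(n - 2, j.+1))%:R
              * (stirling1 (j + 2) 2)%:~R).
Proof.
case: n hn => [|[|[|N]]]// _; rewrite !subSS !subn0.
split=> [|p pE j jN].
  exists (An_poly R N.+1); split; first exact: size_An_poly.
  by move=> b; exact: An_horner.
(* Agreement on positive [b] determines the polynomial. *)
have -> : p = An_poly R N.+1.
  by apply: eq_poly_pos => b b0; rewrite -pE// An_horner.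
rewrite coef_poly ltnS jN addn2 stirling1_2.
(* One sign comes from the stated formula, the other from [stirling1_2]. *)
have sq : (-1) ^+ j * (-1) ^+ j = 1 :> R by rewrite -exprMn mulrNN mulr1 expr1n.
have f0 : (j.+1)`!%:R != 0 :> R by rewrite pnatr_eq0 -lt0n fact_gt0.
rewrite [RHS](_ : _ = ((-1) ^+ j * (-1) ^+ j) * ('C(N.+1, j.+1)%:R * harm R j.+1)).
  by rewrite sq mul1r.
by field.
Qed.
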